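(* Let $n\geq2$ be an integer and let $p_1,\ldots,p_m$ be its distinct prime divisors. Then $T^\ast(n)=\sum_{i}T\!\left(\frac{n}{p_i}\right)-\sum_{i<j}T\!\left(\frac{n}{p_ip_j}\right)+\cdots+(-1)^{m-1}T\!\left(\frac{n}{p_1p_2\cdots p_m}\right)$, i.e. $T^\ast(n)=\sum_{\emptyset\neq S\subseteq\{1,\ldots,m\}}(-1)^{|S|-1}\,T\!\left(n/\prod_{i\in S}p_i\right)$.
   Context: For a vector $A=(a_1,\ldots,a_k)$, $k\geq 1$, of positive integers define $f(A)$ recursively by $f(a_1)=a_1$ and $f(a_1,\ldots,a_{i+1})=(f(a_1,\ldots,a_i)+1)\,a_{i+1}$. For a positive integer $n$, $T(n)$ is the number of vectors $A$ (of any length $k\geq1$, with positive integer entries) such that $f(A)=n$; also $T(0):=1$. For $n\geq1$, $T^\ast(n):=T(n)-T(n-1)$. *)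

(* Defs.v *)
From HB Require Import structures.
From mathcomp Require Import all_boot all_order all_algebra finmap.
From mathcomp Require Import boolp classical_sets functions cardinality.

Set Implicit Arguments.
Unset Strict Implicit.
Unset Printing Implicit Defensive.

(* The value 0 on the empty sequence is never used: vectors have length >= 1. *)
Definition f (A : seq nat) : nat :=
  if A is a :: s then foldl (fun x b => (x + 1) * b) a s else 0.

Lemma f_seq1 (a : nat) : f [:: a] = a.
Proof. by []. Qed.

Lemma f_rcons (A : seq nat) (a : nat) :
  A != [::] -> f (rcons A a) = (f A + 1) * a.
Proof. by case: A => [//|b s] _; rewrite /= foldl_rcons. Qed.

Definition vectors (n : nat) : set (seq nat) :=
  [set A | [/\ A != [::], all (fun a => 0 < a) A & f A = n]]%classic.

(* [fset_set] is the finite set underlying a finite [set], and a default value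
   on infinite ones; this lemma shows that the default is never reached. *)
Lemma finite_vectors (n : nat) : finite_set (vectors n).
Proof.
have bnd (A : seq nat) : A != [::] -> all (fun a => 0 < a) A ->
    size A <= f A /\ all (fun a => a <= f A) A.
  elim/last_ind: A => [//|A a IH] _; rewrite all_rcons => /andP[a0 A0].
  have [->|An] := eqVneq A [::]; first by rewrite /= leqnn.
  rewrite f_rcons // size_rcons all_rcons.
  have [sA aA] := IH An A0.
  have le1 : f A + 1 <= (f A + 1) * a by rewrite leq_pmulr.
  split; first by apply: leq_trans le1; rewrite addn1.
  apply/andP; split; first by rewrite leq_pmull // addn1.
  apply: sub_all aA => x /= xA.
  by apply: leq_trans xA _; apply: leq_trans le1; rewrite leq_addr.
pose g (p : {k : 'I_n.+1 & k.-tuple 'I_n.+1}) := map val (tval (tagged p)).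
apply: (@sub_finite_set _ _ (g @` [set: _])%classic); last first.
  by apply: finite_image; exact: finite_finset.
move=> A [An A0 fA]; have [sA aA] := bnd A An A0; rewrite fA in sA aA.
have sz : size (map (@inord n) A) == Ordinal (sA : size A < n.+1).
  by rewrite size_map.
exists (Tagged (fun k : 'I_n.+1 => k.-tuple 'I_n.+1) (Tuple sz)) => //=.
rewrite /g /= -map_comp -[RHS]map_id; apply/eq_in_map => x xA /=.
by rewrite inordK // ltnS; move/allP: aA; exact.
Qed.

Definition T (n : nat) : nat :=
  if n is 0 then 1 else #|` fset_set (vectors n)|%fset.

Definition Tstar (n : nat) : int := ((T n)%:Z - (T n.-1)%:Z)%R.

(* Main.v *)
Require Import Defs.
From mathcomp Require Import finmap unstable boolp classical_sets cardinality.
From mathcomp Require Import all_boot all_order all_algebra.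

(** The last entry [a] of a vector with value [n] divides [n], and the remaining
    entries form a vector with value [n / a - 1]; summing over [d = n / a] gives
    [T n = \sum_(d %| n) T d.-1]. Substituting this in the inclusion-exclusion
    sum over all sets [S] of prime divisors, the coefficient of [T d.-1] is the
    alternating sum over the sets of primes dividing [n / d], which vanishes
    unless [d = n]; hence the full sum equals [T n.-1]. *)

Import GRing.Theory.

Local Open Scope ring_scope.

(** The value [f [::] = 0] lets the recursion start from the empty vector, so vectors of length one
    need no separate treatment. *)
Lemma f_rcons_total (A : seq nat) (a : nat) : f (rcons A a) = ((f A).+1 * a)%N.
Proof.
case: A => [|b s]; first by rewrite /= mul1n.
by rewrite f_rcons // addn1.
Qed.

Lemma f_gt0 (A : seq nat) :
  A != [::] -> all (fun a => 0 < a)%N A -> (0 < f A)%N.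
Proof.
case/lastP: A => [//|A a] _; rewrite all_rcons f_rcons_total => /andP[a0 _].
by rewrite muln_gt0.
Qed.

(* The empty vector has [f [::] = 0], so including it accounts for [T 0 = 1]. *)
Lemma T_enum (n : nat) : exists s : seq (seq nat),
  [/\ uniq s, size s = T n &
      forall A, (A \in s) = all (fun a => 0 < a)%N A && (f A == n)].
Proof.
case: n => [|n].
  exists [:: [::]]; split => // A; rewrite inE.
  have [->//|An0] := eqVneq A [::].
  by apply/esym/negP => /andP[/(f_gt0 _ An0)]; rewrite lt0n => /negbTE->.
exists (fset_set (vectors n.+1)); split=> //; first exact: fset_uniq.
move=> A; rewrite (in_fset_set (finite_vectors n.+1)).
apply/idP/andP => [|[Apos /eqP fA]]; first by rewrite in_setE => -[_ -> ->].
by rewrite in_setE; split=> //; case: A fA {Apos}.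
Qed.

Lemma T_recurrence (n : nat) :
  (0 < n)%N -> T n = (\sum_(d <- divisors n) T d.-1)%N.
Proof.
move=> n_gt0; have [V V_spec] := choice T_enum.
have Vuniq k : uniq (V k) by case: (V_spec k).
have Vsize k : size (V k) = T k by case: (V_spec k).
have memV k A : (A \in V k) = all (fun a => 0 < a)%N A && (f A == k).
  by case: (V_spec k).
(* For [d = 1], the list [V 0] holds only the empty vector and contributes the one-entry vector
   [[:: n]]. *)
pose W := [seq rcons A (n %/ d)%N | d <- divisors n, A <- V d.-1].
suff /perm_size : perm_eq (V n) W.
  rewrite Vsize size_allpairs_dep sumnE big_map => ->.
  by apply: eq_bigr => d _; rewrite Vsize.
apply: uniq_perm => //.
  apply: allpairs_uniq_dep => [|//|]; first exact: divisors_uniq.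
  (* The divisor is recovered from the prefix as [d = (f A).+1], so no vector arises from two
     different pairs. *)
  have value (u : {_ : nat & seq nat}) :
      u \in [seq existT (fun _ => seq nat) d A
              | d <- divisors n, A <- V d.-1] ->
      tag u = (f (tagged u)).+1.
    case/allpairsPdep => d [A [dn AV ->]] /=.
    move: AV; rewrite memV => /andP[_ /eqP->]; rewrite prednK //.
    by move: dn; rewrite -dvdn_divisors //; apply: (dvdn_gt0 n_gt0).
  move=> [d A] [e B] /value /= dA /value /= eB /rcons_inj[AB _].
  by rewrite dA eB AB.
move=> B; rewrite memV; apply/andP/allpairsPdep.
  case/lastP: B => [|A a]; first by case=> _ /eqP n0; move: n_gt0; rewrite -n0.
  rewrite all_rcons f_rcons_total => -[/andP[a0 A0] /eqP fn].
  exists (f A).+1, A; rewrite memV A0 eqxx -dvdn_divisors // -fn dvdn_mulr //.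
  by rewrite mulKn.
case=> d [A []]; rewrite memV -dvdn_divisors // => dn /andP[A0 /eqP fA] ->.
have d0 : (0 < d)%N by apply: dvdn_gt0 dn.
rewrite all_rcons A0 f_rcons_total fA prednK // muln_divCA // divnn d0 muln1.
by rewrite eqxx divn_gt0 // dvdn_leq.
Qed.

(** Indexing by the divisors of a fixed [n], whatever [k] is, allows the sums over [d] and over sets
    of primes to be exchanged. *)
Lemma T_recurrence_dvd (n k : nat) : (0 < n)%N -> (k %| n)%N ->
  T k = (\sum_(d <- divisors n | d %| k) T d.-1)%N.
Proof.
move=> n0 kn; have k0 : (0 < k)%N by apply: dvdn_gt0 kn.
rewrite T_recurrence // -[RHS]big_filter; apply: perm_big; apply: uniq_perm.
- exact: divisors_uniq.
- exact/filter_uniq/divisors_uniq.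
move=> d; rewrite mem_filter -!dvdn_divisors //.
by case dk: (d %| k)%N => //=; rewrite (dvdn_trans dk kn).
Qed.

(** The sum is the expansion of the product over all [i] of [1 - (i \in B)], in which any element of
    [B] gives a zero factor. *)
Lemma sum_sign_subset (I : finType) (B : {set I}) :
  \sum_(S : {set I} | S \subset B) (-1) ^+ #|S| = (B == set0)%:R :> int.
Proof.
have prod_if (S : {set I}) : \prod_i (if i \in S then - (i \in B)%:R else 1) =
    if S \subset B then (-1) ^+ #|S| else 0 :> int.
  rewrite -big_mkcond /=; case: ifPn => [/subsetP SB|/subsetPn[i iS iB]].
    by rewrite -prodr_const; apply: eq_bigr => i /SB->.
  by rewrite (bigD1 i) //= (negbTE iB) oppr0 mul0r.
transitivity (\prod_(i : I) (- (i \in B)%:R + 1) : int).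
  by rewrite bigA_distr big_mkcond; apply: eq_bigr => S _; rewrite prod_if.
have [->|[i iB]] := set_0Vmem B.
  by rewrite eqxx big1 // => i _; rewrite inE oppr0 add0r.
rewrite (bigD1 i) //= iB addNr mul0r.
by case: eqP iB => // ->; rewrite inE.
Qed.

(** Distinct primes are pairwise coprime, so their product divides [k] as soon as each of them
    does. *)
Lemma prod_primes_dvdn (I : finType) (p : I -> nat) (S : {set I}) (k : nat) :
  injective p -> (forall i, prime (p i)) ->
  (\prod_(i in S) p i %| k)%N = (S \subset [set i | p i %| k]%N).
Proof.
move=> p_inj p_prime.
have coS : pairwise coprime [seq p i | i <- index_enum I & i \in S].
  rewrite pairwise_map.
  apply: (@sub_pairwise _ [rel i j | i != j]) => [i j /=|].
    by rewrite prime_coprime // dvdn_prime2 // (inj_eq p_inj).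
  by rewrite -uniq_pairwise filter_uniq // index_enum_uniq.
apply/(Gauss_dvd_prod k coS)/subsetP => [dvd i iS|sub i _ /sub].
  by rewrite inE dvd // mem_index_enum.
by rewrite inE.
Qed.

Theorem theorem3 (n : nat) (hn : (2 <= n)%N) (m : nat) (p : 'I_m -> nat)
  (p_inj : injective p)
  (p_primes : forall q : nat,
    (prime q /\ (q %| n)%N) <-> (exists i : 'I_m, p i = q)) :
  Tstar n = \sum_(S : {set 'I_m} | S != set0)
    (-1) ^+ (#|S| - 1) * (T (n %/ \prod_(i in S) p i)%N)%:Z.
Proof.
have n0 : (0 < n)%N by apply: ltnW.
have p_spec i : prime (p i) /\ (p i %| n)%N by apply/p_primes; exists i.
have p_prime i : prime (p i) by case: (p_spec i).
pose P (S : {set 'I_m}) := (\prod_(i in S) p i)%N.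
have Pn S : (P S %| n)%N.
  rewrite prod_primes_dvdn //; apply/subsetP => i _.
  by rewrite inE; case: (p_spec i).
have Pgt0 S : (0 < P S)%N by apply: dvdn_gt0 (Pn S).
(* Both sides say that [d * P S] divides [n]. *)
have dvd_swap S d : (d %| n)%N -> (d %| n %/ P S)%N = (P S %| n %/ d)%N.
  move=> dn; have d0 : (0 < d)%N by apply: dvdn_gt0 dn.
  by rewrite !dvdn_divRL // mulnC.
have no_primes d : (d %| n)%N -> ([set i | p i %| n %/ d]%N == set0) = (d == n).
  move=> dn; apply/eqP/eqP => [E|->].
    have d0 : (0 < d)%N by apply: dvdn_gt0 dn.
    have nd0 : (0 < n %/ d)%N by rewrite divn_gt0 // dvdn_leq.
    have [nd1|nd1] := leqP (n %/ d)%N 1.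
      have nd : (n %/ d = 1)%N by apply/eqP; rewrite eqn_leq nd1.
      by rewrite -(divnK dn) nd mul1n.
    (* A prime factor of [n %/ d] also divides [n], hence is some [p i], contradicting the emptiness
       in [E]. *)
    have q_prime := pdiv_prime nd1; have q_dvd := pdiv_dvd (n %/ d)%N.
    have [i pi] : exists i, p i = pdiv (n %/ d)%N.
      by apply/p_primes; split=> //; apply: dvdn_trans q_dvd (dvdn_div dn).
    by have := in_set0 i; rewrite -E inE pi q_dvd.
  apply/setP => i; rewrite !inE divnn n0 dvdn1.
  by apply/negbTE; rewrite neq_ltn prime_gt1 ?orbT.
have full_sum : \sum_(S : {set 'I_m}) (-1) ^+ #|S| * (T (n %/ P S)%N)%:Z =
    (T n.-1)%:Z.
  transitivity (\sum_(S : {set 'I_m}) \sum_(d <- divisors n | (d %| n %/ P S)%N)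
      (-1) ^+ #|S| * (T d.-1)%:Z).
    apply: eq_bigr => S _.
    rewrite (@T_recurrence_dvd n) ?dvdn_div //.
    by rewrite (big_morph Posz PoszD (erefl _)) mulr_sumr.
  rewrite (exchange_big_dep predT) //=.
  transitivity (\sum_(d <- divisors n) (d == n)%:R * (T d.-1)%:Z).
    apply: eq_big_seq => d; rewrite -dvdn_divisors // => dn.
    rewrite -mulr_suml -no_primes // -sum_sign_subset; congr (_ * _).
    by apply: eq_bigl => S; rewrite dvd_swap // prod_primes_dvdn.
  rewrite (bigD1_seq n) ?divisors_uniq -?dvdn_divisors //= eqxx mul1r.
  by rewrite big1 ?addr0 // => d /negbTE->; rewrite mul0r.
(* The empty set contributes [T n] to the full sum, so [Tstar n] is minus the sum of the other
   terms. *)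
rewrite /Tstar -full_sum (bigD1 set0) //= cards0 mul1r {1}/P big_set0 divn1.
rewrite opprD addNKr -sumrN; apply: eq_bigr => S S0.
rewrite -mulNr; congr (_ * _).
(* For nonempty [S] the truncated subtraction [#|S| - 1] is exact, so the exponent drops by one and
   absorbs the minus sign. *)
have : (0 < #|S|)%N by rewrite card_gt0.
by case: #|S| => // k _; rewrite subn1 exprS mulN1r opprK.
Qed.
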